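(* Let $K:\mathcal X\to\mathcal Y$ be a compact linear operator. For any given $n\in\mathbb N$ ($n\ge1$) and $\gamma\ge1/2$, the stationary iterated fractional Tikhonov method (SIFT) with $n$ iterations is a filter based regularization method, with filter function $$F_{\alpha,\gamma}^{(n)}(\sigma)=\frac{(\sigma^2+\alpha)^{\gamma n}-\big[(\sigma^2+\alpha)^\gamma-\sigma^{2\gamma}\big]^n}{(\sigma^2+\alpha)^{\gamma n}}.$$ Moreover, the method is of optimal order under the a-priori assumption $x^\dagger\in\mathcal X_{\nu,\rho}$, for $\gamma\ge1/2$ and $0<\nu\le2n$, with best convergence rate $$\|x^\dagger-x_{\alpha,\gamma}^{n,\delta}\|=O\big(\delta^{\frac{2n}{2n+1}}\big),$$ which is obtained for $\alpha=(\delta/\rho)^{\frac{2}{\nu+1}}$ with $\nu=2n$. On the other hand, if $\|x^\dagger-x_{\alpha,\gamma}^n\|=O(\alpha^n)$ as $\alpha\to0$, then $x^\dagger\in\mathcal X_{2n}$.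
   Context: $\mathcal X,\mathcal Y$ are Hilbert spaces. $(\sigma_m;v_m,u_m)$ is the singular value expansion of $K$: $\sigma_1\ge\sigma_2\ge\dots>0$, $\{v_m\}$, $\{u_m\}$ orthonormal and complete in $(\ker K)^\perp$ and $\overline{R(K)}$, $Kv_m=\sigma_mu_m$, $K^*u_m=\sigma_mv_m$. $K^\dagger y=\sum_m\sigma_m^{-1}\langle y,u_m\rangle v_m$ for $y\in\mathcal D(K^\dagger)=\{y:\sum_m\sigma_m^{-2}|\langle y,u_m\rangle|^2<\infty\}$. The exact datum $y$ is attainable and $x^\dagger=K^\dagger y$; $y^\delta\in\mathcal Y$ is a noisy datum with $\|y-y^\delta\|\le\delta$. SIFT: for $\alpha>0$, $\gamma\ge1/2$, $x_{\alpha,\gamma}^0=0$ and $$(K^*K+\alpha I)^\gamma x_{\alpha,\gamma}^n=(K^*K)^{\gamma-1}K^*y+\big[(K^*K+\alpha I)^\gamma-(K^*K)^\gamma\big]x_{\alpha,\gamma}^{n-1},$$ where $(K^*K)^{\gamma-1}K^*y:=\sum_m\sigma_m^{2\gamma-1}\langle y,u_m\rangle v_m$. $x_{\alpha,\gamma}^{n,\delta}$ is the $n$-th iterate when $y$ is replaced by $y^\delta$. The iteration number $n$ is fixed and $\alpha$ is the regularization parameter, i.e. $R_\alpha y=x_{\alpha,\gamma}^n$. A filter based regularization method with filter function $F_\alpha$ is a family $R_\alpha y=\sum_mF_\alpha(\sigma_m)\sigma_m^{-1}\langle y,u_m\rangle v_m$, $\alpha\in(0,\alpha_0)$ ($\alpha_0\in(0,\infty]$),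 with $F_\alpha$ Borel such that $\sup_m|F_\alpha(\sigma_m)\sigma_m^{-1}|<\infty$ for each $\alpha$; $|F_\alpha(\sigma_m)|\le C$ with $C$ independent of $(\alpha,m)$; $\lim_{\alpha\to0}F_\alpha(\sigma_m)=1$ for each $m$. $\mathcal X_{\nu,\rho}=\{x\in\mathcal X:\ x=(K^*K)^{\nu/2}\omega,\ \|\omega\|\le\rho\}$ and $\mathcal X_\nu=\bigcup_{\rho>0}\mathcal X_{\nu,\rho}$. A method $R_\alpha$ is of optimal order under the a-priori assumption $x^\dagger\in\mathcal X_{\nu,\rho}$ if, with a suitable choice $\alpha=\alpha(\delta,\rho)$, $\sup\{\|x^\dagger-R_\alpha y^\delta\|:x^\dagger\in\mathcal X_{\nu,\rho},\|y-y^\delta\|\le\delta\}\le c\,\delta^{\frac{\nu}{\nu+1}}\rho^{\frac1{\nu+1}}$ with $c$ independent of $\delta,\rho$. ''Best convergence rate'' refers to the largest exponent among the optimal-order rates $\delta^{\nu/(\nu+1)}$ for the admissible range of $\nu$. *)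

(* Defs.v *)
From HB Require Import structures.
From mathcomp Require Import all_boot all_order all_algebra.
From mathcomp Require Import sesquilinear complex.
From mathcomp Require Import all_classical all_reals all_analysis.
Set Implicit Arguments.
Unset Strict Implicit.
Unset Printing Implicit Defensive.
Import Order.TTheory GRing.Theory Num.Theory.
Import numFieldNormedType.Exports.
Local Open Scope classical_set_scope.
Local Open Scope ring_scope.

(* Hilbert spaces are taken over either the real or the complex scalars;
   singular values, parameters and exponents always live in R. *)
Variant scalars := RealScalars | ComplexScalars.

Definition scal (R : realType) (k : scalars) : numFieldType :=
  match k with RealScalars => R | ComplexScalars => R[i] end.

Definition scal_conj (R : realType) (k : scalars) :
    {rmorphism scal R k -> scal R k} :=
  match k with RealScalars => idfun | ComplexScalars => @Num.conj R[i] end.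

Definition of_real (R : realType) (k : scalars) : R -> scal R k :=
  match k with
  | RealScalars => fun r => r
  | ComplexScalars => fun r => Complex r 0
  end.

Definition re_part (R : realType) (k : scalars) : scal R k -> R :=
  match k with RealScalars => fun r => r | ComplexScalars => @complex.Re R end.

(* {dot _ for _} is linear in its first argument and conjugate-linear in the
   second one. *)
Record hilbertSpace (R : realType) (k : scalars) := HilbertSpace {
  hilbert_sort :> completeNormedModType (scal R k) ;
  hilbert_dot : {dot hilbert_sort for scal_conj R k} ;
  hilbert_dotE : forall x : hilbert_sort, hilbert_dot x x = `|x| ^+ 2 }.

Definition ip (R : realType) (k : scalars) (X : hilbertSpace R k) (x y : X) :
  scal R k := hilbert_dot X x y.

(* `|x| lives in the scalar field; this is the same number seen in R. *)
Definition rnorm (R : realType) (k : scalars) (X : hilbertSpace R k) (x : X) :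
  R := re_part `|x|.

Definition orthogonal_to (R : realType) (k : scalars) (X : hilbertSpace R k)
  (A : set X) : set X := [set x | forall a, A a -> ip x a = 0].

Definition compact_operator (R : realType) (k : scalars)
    (X Y : hilbertSpace R k) (K : X -> Y) : Prop :=
  forall A : set X, bounded_set A -> precompact (K @` A).

Definition is_adjoint (R : realType) (k : scalars) (X Y : hilbertSpace R k)
    (K : X -> Y) (Kadj : Y -> X) : Prop :=
  forall x y, ip (K x) y = ip x (Kadj y).

(* (e m), m in I, is an orthonormal system of V, complete in V. *)
Definition complete_orthonormal (R : realType) (k : scalars)
    (X : hilbertSpace R k) (V : set X) (I : set nat) (e : nat -> X) : Prop :=
  [/\ forall m, I m -> V (e m),
      forall m p, I m -> I p -> ip (e m) (e p) = (m == p)%:R &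
      forall x, V x -> (forall m, I m -> ip x (e m) = 0) -> x = 0].

(* The index set is an initial segment of nat, finite when K has finite rank;
   values at indices outside of it are irrelevant.  Indices start at 0. *)
Record sing_val_exp (R : realType) (k : scalars) (X Y : hilbertSpace R k)
    (K : X -> Y) (Kadj : Y -> X) := SingValExp {
  sve_idx : set nat ;
  sv : nat -> R ;
  vvec : nat -> X ;
  uvec : nat -> Y ;
  sve_initial : forall m p, (m <= p)%N -> sve_idx p -> sve_idx m ;
  sv_gt0 : forall m, sve_idx m -> 0 < sv m ;
  sv_noninc : forall m p, (m <= p)%N -> sve_idx p -> sv p <= sv m ;
  sve_v : complete_orthonormal
    (orthogonal_to [set x | K x = 0]) sve_idx vvec ;
  sve_u : complete_orthonormal (closure (range K)) sve_idx uvec ;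
  sve_Kv : forall m, sve_idx m -> K (vvec m) = of_real k (sv m) *: uvec m ;
  sve_Kadju : forall m, sve_idx m ->
    Kadj (uvec m) = of_real k (sv m) *: vvec m }.

Section spectral.
Context (R : realType) (k : scalars) (X Y : hilbertSpace R k).
Context (K : X -> Y) (Kadj : Y -> X) (S : sing_val_exp K Kadj).

Definition sve_partial (f : nat -> X) : nat -> X :=
  fun N => \sum_(m < N | nat_of_ord m \in sve_idx S) f m.

Definition sve_sum (f : nat -> X) : X := limn (sve_partial f).

(* phi(K^*K); the last summand is phi(0) times the orthogonal projection onto
   ker K. *)
Definition fun_KadjK (phi : R -> R) (x : X) : X :=
  sve_sum (fun m => (of_real k (phi (sv S m ^+ 2)) * ip x (vvec S m))
                      *: vvec S m)
  + of_real k (phi 0) *: (x - sve_sum (fun m => ip x (vvec S m) *: vvec S m)).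

(* The limit exists exactly when y is in the domain of K^dagger. *)
Definition pseudo_inv (y : Y) : X :=
  sve_sum (fun m => (of_real k (sv S m)^-1 * ip y (uvec S m)) *: vvec S m).

(* (K^*K)^(gamma-1) K^* y *)
Definition pow_KadjK_Kadj (gamma : R) (y : Y) : X :=
  sve_sum (fun m => (of_real k (sv S m `^ (2 * gamma - 1)) * ip y (uvec S m))
                      *: vvec S m).

Definition sift_equation (alpha gamma : R) (y : Y) (xprev x : X) : Prop :=
  fun_KadjK (fun t => (t + alpha) `^ gamma) x =
  pow_KadjK_Kadj gamma y
  + (fun_KadjK (fun t => (t + alpha) `^ gamma) xprev
     - fun_KadjK (fun t => t `^ gamma) xprev).

(* For alpha > 0 the operator (K^*K + alpha I)^gamma is bijective, so xget
   returns the unique solution of the step equation. *)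
Definition sift (gamma : R) (n : nat) (alpha : R) (y : Y) : X :=
  iter n (fun xprev => xget 0 [set x | sift_equation alpha gamma y xprev x]) 0.

Definition filter_regularization (alpha0 : \bar R) (F : R -> R -> R)
    (Ralpha : R -> Y -> X) : Prop :=
  [/\ (0 < alpha0)%E,
      forall alpha, 0 < alpha -> (alpha%:E < alpha0)%E ->
        [/\ @measurable_fun _ _ (measurableTypeR R) (measurableTypeR R)
              `[0, +oo[%classic (F alpha),
            exists M, forall m, sve_idx S m ->
              `|F alpha (sv S m) * (sv S m)^-1| <= M &
            forall y,
              sve_partial
                (fun m => (of_real k (F alpha (sv S m) * (sv S m)^-1)
                             * ip y (uvec S m)) *: vvec S m) @ \oo
              --> Ralpha alpha y],
      exists C, forall alpha m, 0 < alpha -> (alpha%:E < alpha0)%E ->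
        sve_idx S m -> `|F alpha (sv S m)| <= C &
      forall m, sve_idx S m -> F alpha (sv S m) @[alpha --> 0^'+] --> (1 : R)].

Definition source_ball (nu rho : R) : set X :=
  [set x | exists w, x = fun_KadjK (fun t => t `^ (nu / 2)) w /\
                     rnorm w <= rho].

Definition source_space (nu : R) : set X :=
  [set x | exists rho, 0 < rho /\ source_ball nu rho x].

(* The supremum runs over attainable data y, with x^dagger = K^dagger y. *)
Definition worst_case_error (Ra : Y -> X) (nu delta rho : R) : \bar R :=
  ereal_sup [set e | exists y yd, [/\ range K y,
    source_ball nu rho (pseudo_inv y), rnorm (y - yd) <= delta &
    e = (rnorm (pseudo_inv y - Ra yd))%:E]].

Definition optimal_order_with (alpha0 : \bar R) (Ralpha : R -> Y -> X)
    (nu : R) (choice : R -> R -> R) : Prop :=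
  exists c, forall delta rho, 0 < delta -> 0 < rho ->
    [/\ 0 < choice delta rho, ((choice delta rho)%:E < alpha0)%E &
     (worst_case_error (Ralpha (choice delta rho)) nu delta rho <=
      (c * delta `^ (nu / (nu + 1)) * rho `^ (1 / (nu + 1)))%:E)%E].

Definition optimal_order (alpha0 : \bar R) (Ralpha : R -> Y -> X) (nu : R) :
  Prop := exists choice, optimal_order_with alpha0 Ralpha nu choice.

End spectral.

Definition sift_filter (R : realType) (gamma : R) (n : nat)
    (alpha sigma : R) : R :=
  ((sigma ^+ 2 + alpha) `^ (gamma * n%:R)
   - ((sigma ^+ 2 + alpha) `^ gamma - sigma `^ (2 * gamma)) ^+ n)
  / (sigma ^+ 2 + alpha) `^ (gamma * n%:R).

(* Main.v *)
Require Import Defs.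
From HB Require Import structures.
From mathcomp Require Import all_boot all_order all_algebra.
From mathcomp Require Import sesquilinear complex.
From mathcomp Require Import all_classical all_reals all_analysis.
From mathcomp Require Import measurable_realfun ring lra.
Set Implicit Arguments.
Unset Strict Implicit.
Unset Printing Implicit Defensive.
Import Order.TTheory GRing.Theory Num.Theory.
Import numFieldNormedType.Exports.
Local Open Scope classical_set_scope.
Local Open Scope ring_scope.

(** Everything is diagonal in the singular system.  An element of X is treated
    through its coefficients along the [v_m]: partial sums of an orthonormal
    expansion converge as soon as the squared moduli of the coefficients have
    bounded partial sums ([l2_bounded_cvg]), the limit recovers the coefficients
    ([expands_ip]), and a bound on the squared sums bounds the norm
    ([expands_rnorm_le], with Bessel's inequality for the converse).

    Solving the step equation coefficientwise shows that the [n]-th iterate has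
    coefficients [F(sigma_m) / sigma_m * <y, u_m>] ([sift_expands]); here
    [F = 1 - r ^ n], where [r = 1 - q ^ gamma] is the factor by which one step
    shrinks the error and [q = sigma ^ 2 / (sigma ^ 2 + alpha)].  All the
    estimates are then about [r], which behaves like the residual
    [1 - q = alpha / (sigma ^ 2 + alpha)] of classical Tikhonov regularization:
    [(1 - q) / 2 <= r <= N (1 - q)] for every integer [N >= gamma].  The lower
    bound uses [gamma >= 1 / 2] in the form [q ^ gamma <= sqrt q], the upper
    one is Bernoulli's inequality.

    - Noise: [F <= n q ^ gamma <= n sqrt q <= n sigma / sqrt alpha], so the data
      error is amplified by at most [n / sqrt alpha] ([sift_rnorm_le]).
    - Approximation: [sigma ^ nu r ^ n <= N ^ n alpha ^ (nu / 2)] when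
      [nu <= 2 n], so a source element is approximated up to
      [N ^ n alpha ^ (nu / 2) rho] ([sift_error_source_le]).  The choice
      [alpha = (delta / rho) ^ (2 / (nu + 1))] balances the two
      ([parameter_choiceE]).
    - Converse: if the error is at most [C alpha ^ n], Bessel's inequality bounds
      the squared sum of [r ^ n <x, v_m> / alpha ^ n].  On finitely many indices
      [alpha] can be taken below all [sigma_m ^ 2], where
      [r / alpha >= 1 / (4 sigma_m ^ 2)]; hence the [sigma_m ^ (- 2 n) <x, v_m>]
      are square summable, and their expansion is the source element sought
      ([source_space_of_rate]). *)

(** * Real and complex scalars *)

Section Scalars.
Context (R : realType) (k : scalars).
Local Notation C := (scal R k).
Local Notation "r %:K" := (of_real k r) (at level 1, format "r %:K").

Lemma of_real_zmod_morphism : zmod_morphism (of_real k : R -> C).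
Proof. by case: k => x y //=; apply/eqP; rewrite eq_complex /= subr0 !eqxx. Qed.

Lemma of_real_monoid_morphism : monoid_morphism (of_real k : R -> C).
Proof.
case: k; split=> // x y /=; apply/eqP.
by rewrite eq_complex /= mulr0 subr0 mul0r mulr0 addr0 !eqxx.
Qed.

HB.instance Definition _ := GRing.isZmodMorphism.Build R C (of_real k)
  of_real_zmod_morphism.
HB.instance Definition _ := GRing.isMonoidMorphism.Build R C (of_real k)
  of_real_monoid_morphism.

Lemma of_realK (r : R) : @re_part R k r%:K = r.
Proof. by case: k. Qed.

Lemma re_partK (z : C) : 0 <= z -> (@re_part R k z)%:K = z.
Proof.
case: k z => // -[a b]; rewrite lecE /= => /andP[/eqP -> _].
by [].
Qed.

Lemma ler_of_real (a b : R) : (a%:K <= b%:K) = (a <= b).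
Proof. by case: k => //=; rewrite lecE /= eqxx. Qed.

Lemma ltr_of_real (a b : R) : (a%:K < b%:K) = (a < b).
Proof. by case: k => //=; rewrite ltcE /= eqxx. Qed.

Lemma norm_of_real (r : R) : `|r%:K| = (`|r|)%:K.
Proof. by case: k => //=; rewrite normc_def /= expr0n /= addr0 sqrtr_sqr. Qed.

Lemma conj_of_real (r : R) : scal_conj R k (r%:K) = r%:K.
Proof. by case: k => //=; rewrite -[Num.conj _]/(conjc _) /= oppr0. Qed.

Lemma mul_conj (z : C) : z * scal_conj R k z = `|z| ^+ 2.
Proof.
by case: k z => z /=; [rewrite -normrX ger0_norm ?sqr_ge0| rewrite normCK].
Qed.

(** Sums of squared coefficients are compared with real bounds, so moduli are
    brought back from the scalar field, whose order is only partial when it is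
    complex, to R. *)
Definition rabs (z : C) : R := @re_part R k `|z|.

Lemma rabsE (z : C) : (rabs z)%:K = `|z|.
Proof. exact: re_partK. Qed.

Lemma rabs_ge0 (z : C) : 0 <= rabs z.
Proof. by rewrite -ler_of_real rabsE rmorph0. Qed.

Lemma rabsM (y z : C) : rabs (y * z) = rabs y * rabs z.
Proof. by rewrite -[RHS]of_realK rmorphM /= !rabsE -normrM. Qed.

Lemma rabs_of_real (r : R) : rabs (r%:K) = `|r|.
Proof. by rewrite /rabs norm_of_real of_realK. Qed.

End Scalars.

(** * Orthonormal systems *)

Section InnerProduct.
Context (R : realType) (k : scalars) (H : hilbertSpace R k).
Local Notation C := (scal R k).
Local Notation "r %:K" := (of_real k r) (at level 1, format "r %:K").

Lemma rnormE (x : H) : (rnorm x)%:K = `|x|.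
Proof. exact: re_partK. Qed.

Lemma rnorm_ge0 (x : H) : 0 <= rnorm x.
Proof. by rewrite -(ler_of_real k) rnormE rmorph0. Qed.

Lemma ler_rnormD (x y : H) : rnorm (x + y) <= rnorm x + rnorm y.
Proof. by rewrite -(ler_of_real k) rmorphD /= !rnormE ler_normD. Qed.

Lemma ipxx (x : H) : ip x x = (rnorm x ^+ 2)%:K.
Proof. by rewrite rmorphXn /= rnormE -hilbert_dotE. Qed.

Lemma ipDl (x y z : H) : ip (x + y) z = ip x z + ip y z.
Proof. by rewrite /ip linearDl. Qed.

Lemma ipBl (x y z : H) : ip (x - y) z = ip x z - ip y z.
Proof. by rewrite /ip linearBl. Qed.

Lemma ipZl a (x z : H) : ip (a *: x) z = a * ip x z.
Proof. by rewrite /ip linearZl_LR. Qed.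

Lemma ip_conj (x y : H) : ip x y = scal_conj R k (ip y x).
Proof. by rewrite /ip hermC expr0 mul1r. Qed.

Lemma ipBr (x y z : H) : ip x (y - z) = ip x y - ip x z.
Proof. by rewrite ip_conj ipBl rmorphB /= -!ip_conj. Qed.

Lemma ip_suml (A : Type) (r : seq A) (P : pred A) (f : A -> H) z :
  ip (\sum_(i <- r | P i) f i) z = \sum_(i <- r | P i) ip (f i) z.
Proof.
apply: (big_morph (fun x => ip x z)) => [x y|]; first exact: ipDl.
by rewrite -(subrr (0 : H)) ipBl subrr.
Qed.

End InnerProduct.

Section OrthonormalSystem.
Context (R : realType) (k : scalars) (H : hilbertSpace R k).
Context (I : set nat) (e : nat -> H).
Hypothesis e_on : forall m p, I m -> I p -> ip (e m) (e p) = (m == p)%:R.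
Local Notation C := (scal R k).
Local Notation "r %:K" := (of_real k r) (at level 1, format "r %:K").

Lemma ip_osum (a : nat -> C) (r : seq nat) p : uniq r -> p \in I -> p \in r ->
  ip (\sum_(m <- r | m \in I) a m *: e m) (e p) = a p.
Proof.
move=> ur Ip pr; rewrite ip_suml big_mkcond (bigD1_seq p) //= Ip.
rewrite ipZl e_on ?eqxx ?mulr1; try exact/set_mem.
rewrite big1 ?addr0 // => m mp; case: ifP => // Im.
by rewrite ipZl e_on ?(negbTE mp) ?mulr0; try exact/set_mem.
Qed.

(** Pythagoras: the coefficients of the finite sum [s] against the [e m] are the
    [a m], so expanding the left factor of [ip s s] is enough. *)
Lemma rnorm_osum (a : nat -> C) (r : seq nat) : uniq r ->
  rnorm (\sum_(m <- r | m \in I) a m *: e m) ^+ 2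
  = \sum_(m <- r | m \in I) rabs (a m) ^+ 2.
Proof.
move=> ur; apply: (can_inj (@of_realK R k)); rewrite -ipxx rmorph_sum /=.
set s := \sum_(m <- r | m \in I) _; rewrite {1}/s ip_suml.
rewrite big_seq_cond [RHS]big_seq_cond; apply: eq_bigr => m /andP[mr Im].
by rewrite ipZl [ip (e m) s]ip_conj ip_osum // mul_conj rmorphXn /= rabsE.
Qed.

(** The partial expansion [s] is orthogonal to [x - s], so its squared norm is
    that of [x] minus that of [x - s]. *)
Lemma bessel (x : H) (r : seq nat) : uniq r ->
  \sum_(m <- r | m \in I) rabs (ip x (e m)) ^+ 2 <= rnorm x ^+ 2.
Proof.
move=> ur; set s := \sum_(m <- r | m \in I) ip x (e m) *: e m.
have os z : (forall m, m \in I -> m \in r -> ip z (e m) = 0) -> ip s z = 0.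
  move=> z0; rewrite ip_suml big_seq_cond big1 // => m /andP[mr Im].
  by rewrite ipZl [ip (e m) z]ip_conj z0 // rmorph0 mulr0.
have sxs : ip s (x - s) = 0.
  by apply: os => m Im mr; rewrite ipBl ip_osum // subrr.
have sxE : ip s x = ip s s by apply/eqP; rewrite -subr_eq0 -ipBr sxs.
have xE : ip x x = ip (x - s) (x - s) + ip s s.
  rewrite ipBr !ipBl [ip x s]ip_conj sxE -ip_conj.
  by rewrite subrr subr0 subrK.
rewrite -rnorm_osum // -(ler_of_real k) -!ipxx -/s xE lerDr ipxx.
by rewrite -[0](rmorph0 (of_real k)) ler_of_real sqr_ge0.
Qed.

(** Cauchy-Schwarz against a unit vector, as Bessel with one term. *)
Lemma rabs_ip_le (x : H) p : p \in I -> rabs (ip x (e p)) <= rnorm x.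
Proof.
move=> Ip; rewrite -(@ler_pXn2r _ 2) ?nnegrE ?rabs_ge0 ?rnorm_ge0 //.
by have := @bessel x [:: p] isT; rewrite big_cons Ip big_nil addr0.
Qed.

End OrthonormalSystem.

(** * Square summable coefficients *)

Section Expansions.
Context (R : realType) (k : scalars) (H : hilbertSpace R k).
Context (I : set nat) (e : nat -> H).
Hypothesis e_on : forall m p, I m -> I p -> ip (e m) (e p) = (m == p)%:R.
Local Notation C := (scal R k).
Local Notation "r %:K" := (of_real k r) (at level 1, format "r %:K").

Definition osum (a : nat -> C) : nat -> H :=
  fun N => \sum_(m < N | nat_of_ord m \in I) a m *: e m.

Definition expands_to (a : nat -> C) (x : H) : Prop := osum a @ \oo --> x.

(** Partial sums stand for the value of the series, so that no convergence of
    the real series has to be carried along; [B] plays the part of a norm. *)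
Definition l2_bounded (a : nat -> C) (B : R) : Prop :=
  forall N, \sum_(0 <= m < N | m \in I) rabs (a m) ^+ 2 <= B ^+ 2.

Lemma osumE a N : osum a N = \sum_(0 <= m < N | m \in I) a m *: e m.
Proof. by rewrite big_mkord. Qed.

(** Riesz-Fischer: by Pythagoras, blocks of the vector series have the same
    squared norm as the corresponding blocks of a real series of nonnegative
    terms, which is Cauchy because it is bounded; completeness concludes. *)
Lemma l2_bounded_cvg a B : l2_bounded a B -> exists x, expands_to a x.
Proof.
move=> aB.
pose A m := if m \in I then rabs (a m) ^+ 2 else 0.
have A_ge0 m : 0 <= A m by rewrite /A; case: ifP => //; rewrite sqr_ge0.
have /cauchy_cvgP/cauchy_seriesP A_cauchy : cvgn (series A).
  apply: nondecreasing_is_cvgn.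
    by apply/nondecreasing_seqP => m; rewrite !seriesEnat /= big_nat_recr //= lerDl.
  exists (B ^+ 2) => _ [N _ <-].
  by rewrite seriesEnat /= -big_mkcond /=; exact: aB.
pose f m := if m \in I then a m *: e m else 0.
have osumf : osum a = series f.
  by apply/funext => N; rewrite osumE seriesEnat /= -big_mkcond.
suff : cvgn (series f) by rewrite -osumf => cf; exists (limn (osum a)).
apply/cauchy_cvgP/cauchy_seriesP => eps eps_gt0.
(* The tolerance is a positive element of the scalar field, hence the image of
   a positive real [d]. *)
pose d := @re_part R k eps; have epsE : eps = d%:K by rewrite re_partK // ltW.
have d_gt0 : 0 < d by rewrite -(ltr_of_real k) -epsE rmorph0.
have := A_cauchy _ (exprn_gt0 2 d_gt0).
apply: filterS => -[i j] /=; rewrite ger0_norm ?sumr_ge0 // => Ad.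
rewrite epsE -rnormE ltr_of_real -(@ltr_pXn2r _ 2) ?nnegrE ?rnorm_ge0 ?ltW //.
by rewrite -big_mkcond /= rnorm_osum ?iota_uniq // big_mkcond.
Qed.

Lemma expands_lim a x : expands_to a x -> limn (osum a) = x.
Proof. by move=> ax; apply: cvg_lim => //; exact: norm_hausdorff. Qed.

Lemma expands_near a x (eps : R) : expands_to a x -> 0 < eps ->
  exists N0, forall N, (N0 <= N)%N -> rnorm (x - osum a N) < eps.
Proof.
move=> /cvgrPdist_lt ax eps_gt0.
have [|N0 _ HN] := ax eps%:K; first by rewrite -[0](rmorph0 (of_real k)) ltr_of_real.
by exists N0 => N /HN /=; rewrite -rnormE ltr_of_real.
Qed.

(** Partial sums beyond [p] have coefficient [a p] exactly, and taking
    coefficients is 1-Lipschitz. *)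
Lemma expands_ip a x p : expands_to a x -> I p -> ip x (e p) = a p.
Proof.
move=> ax /mem_set Ip; apply/eqP; rewrite -subr_eq0 -normr_eq0 -rabsE.
set z := _ - _; apply/eqP; rewrite -[RHS](rmorph0 (of_real k)); congr (_%:K).
apply/eqP; rewrite eq_le rabs_ge0 andbT leNgt; apply/negP => z_gt0.
have [N0 HN] := expands_near ax z_gt0.
have := HN (maxn N0 p.+1) (leq_maxl _ _); apply/negP; rewrite -leNgt.
apply: le_trans (rabs_ip_le e_on _ Ip); rewrite ipBl osumE ip_osum //.
  exact: iota_uniq.
by rewrite mem_index_iota /= leq_max ltnSn orbT.
Qed.

Lemma bessel_l2 x : l2_bounded (fun m => ip x (e m)) (rnorm x).
Proof. by move=> N; apply: bessel => //; exact: iota_uniq. Qed.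

Lemma eq_expands a b x :
  (forall m, I m -> a m = b m) -> expands_to a x -> expands_to b x.
Proof.
move=> ab; rewrite /expands_to (_ : osum a = osum b) //.
by apply/funext => N; apply: eq_bigr => m /set_mem /ab ->.
Qed.

Lemma expands_uniq a x y : expands_to a x -> expands_to a y -> x = y.
Proof. by move=> /expands_lim <- /expands_lim. Qed.

Lemma expandsD a b x y : expands_to a x -> expands_to b y ->
  expands_to (fun m => a m + b m) (x + y).
Proof.
move=> ax bx; rewrite /expands_to.
rewrite (_ : osum _ = osum a \+ osum b); first exact: cvgD.
apply/funext => N /=; rewrite -big_split /=.
by apply: eq_bigr => m _; rewrite scalerDl.
Qed.

Lemma expandsB a b x y : expands_to a x -> expands_to b y ->
  expands_to (fun m => a m - b m) (x - y).
Proof.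
move=> ax bx; rewrite /expands_to.
rewrite (_ : osum _ = osum a \- osum b); first exact: cvgB.
apply/funext => N /=; rewrite -sumrB.
by apply: eq_bigr => m _; rewrite scalerBl.
Qed.

Lemma expands0 : expands_to (fun=> 0) 0.
Proof.
rewrite /expands_to (_ : osum _ = fun=> 0); first exact: cvg_cst.
by apply/funext => N; rewrite /osum big1 // => m _; rewrite scale0r.
Qed.

Lemma expands_rnorm_le a x B : 0 <= B -> expands_to a x -> l2_bounded a B ->
  rnorm x <= B.
Proof.
move=> B_ge0 ax aB; apply/ler_addgt0Pr => eps eps_gt0.
have [N /(_ N (leqnn N)) HN] := expands_near ax eps_gt0.
rewrite -[x](subrK (osum a N)) addrC; apply: le_trans (ler_rnormD _ _) _.
rewrite lerD ?(ltW HN) // -(@ler_pXn2r _ 2) ?nnegrE ?rnorm_ge0 //.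
by rewrite osumE rnorm_osum ?iota_uniq.
Qed.

Lemma expands_l2 a x : expands_to a x -> l2_bounded a (rnorm x).
Proof.
move=> ax N; apply: le_trans (bessel_l2 x N).
by apply: ler_sum => m /set_mem Im; rewrite (expands_ip ax Im).
Qed.

End Expansions.

(** A bounded diagonal operator; [a] may be the coefficients of a vector of
    another space, as when passing from data in Y to solutions in X. *)
Lemma l2_multiplier (R : realType) (k : scalars) (I : set nat)
    (b : nat -> R) (a : nat -> scal R k) (M B : R) :
  (forall m, I m -> `|b m| <= M) -> l2_bounded I a B ->
  l2_bounded I (fun m => of_real k (b m) * a m) (M * B).
Proof.
move=> bM aB N; rewrite exprMn.
apply: le_trans (ler_wpM2l (sqr_ge0 M) (aB N)); rewrite mulr_sumr.
apply: ler_sum => m /set_mem /bM bmM.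
rewrite rabsM rabs_of_real exprMn ler_wpM2r ?sqr_ge0 //.
by rewrite ler_pXn2r ?nnegrE // (le_trans _ bmM).
Qed.

(** * The scalar iteration *)

Section ScalarEstimates.
Context (R : realType).
Implicit Types (gamma alpha s nu x : R) (n N : nat).

(** The factor by which one exact step multiplies the error component along a
    singular vector of singular value [s]. *)
Definition sift_residual gamma alpha s : R :=
  1 - (s ^+ 2 / (s ^+ 2 + alpha)) `^ gamma.

Lemma bernoulli x n : 0 <= x <= 1 -> 1 - x ^+ n <= n%:R * (1 - x).
Proof.
move=> /andP[x0 x1]; elim: n => [|n IH]; first by rewrite expr0 subrr mul0r.
have xn1 : x ^+ n <= 1 by rewrite exprn_ile1.
have -> : 1 - x ^+ n.+1 = (1 - x) + x * (1 - x ^+ n) by rewrite exprS; ring.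
rewrite -natr1 mulrDl mul1r addrC lerD2r.
by apply: le_trans IH; rewrite ler_piMl // subr_ge0.
Qed.

Lemma powR_sqr s gamma : 0 <= s -> s `^ (2 * gamma) = (s ^+ 2) `^ gamma.
Proof. by move=> s0; rewrite powRrM powR_mulrn. Qed.

Lemma powR_div x y gamma : 0 <= x -> 0 <= y ->
  (x / y) `^ gamma = x `^ gamma / y `^ gamma.
Proof.
move=> x0 y0; rewrite powRM ?invr_ge0 // -[y^-1]powR_inv1 // powRAC.
by rewrite powR_inv1 ?powR_ge0.
Qed.

Section Residual.
Variables (gamma alpha s : R).
Hypotheses (gamma_ge : 1 / 2 <= gamma) (alpha_gt0 : 0 < alpha) (s_gt0 : 0 < s).
Let gamma_ge0 : 0 <= gamma.
Proof. by apply: le_trans gamma_ge; rewrite divr_ge0. Qed.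
Let gamma_ge2V : 2^-1 <= gamma.
Proof. by rewrite -div1r. Qed.
Let q := s ^+ 2 / (s ^+ 2 + alpha).
Let A_gt0 : 0 < s ^+ 2 + alpha.
Proof. by rewrite addr_gt0 ?exprn_gt0. Qed.

Lemma spectral_ratio : 0 < q <= 1.
Proof.
by rewrite /q divr_gt0 ?exprn_gt0 //= ler_pdivrMr // mul1r lerDl ltW.
Qed.

Lemma one_minus_ratio : 1 - q = alpha / (s ^+ 2 + alpha).
Proof. by rewrite /q; field; rewrite gt_eqF. Qed.

Lemma sift_residual_ge0_le1 : 0 <= sift_residual gamma alpha s <= 1.
Proof.
rewrite /sift_residual -/q lerBlDr lerDl powR_ge0 andbT subr_ge0.
have q01 := spectral_ratio; have /andP[q0 q1] := q01.
by rewrite -(powRr0 q) ger_powR.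
Qed.

Lemma sift_filterE n :
  sift_filter gamma n alpha s = 1 - sift_residual gamma alpha s ^+ n.
Proof.
rewrite /sift_filter /sift_residual powR_sqr ?ltW // powRrM.
rewrite powR_mulrn ?powR_ge0 // powR_div ?ltW ?exprn_gt0 //.
have A0 : (s ^+ 2 + alpha) `^ gamma != 0 by rewrite gt_eqF ?powR_gt0.
set A := _ `^ gamma in A0 *; set B := _ `^ gamma.
have -> : 1 - B / A = (A - B) / A by field.
rewrite expr_div_n mulrBl divff ?expf_neq0 //.
Qed.

(** Replacing the exponent [gamma] by a larger integer [N] lowers the power of
    [q] and makes Bernoulli's inequality available; the loss of sharpness in the
    constant does not affect the rates. *)
Lemma sift_residual_le N : gamma <= N%:R ->
  sift_residual gamma alpha s <= N%:R * (alpha / (s ^+ 2 + alpha)).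
Proof.
move=> gN; have q01 := spectral_ratio; have /andP[q0 q1] := q01.
rewrite -one_minus_ratio; apply: (le_trans _ (@bernoulli q N _)); last first.
  by rewrite (ltW q0).
by rewrite lerB // -powR_mulrn ?(ltW q0) // ger_powR.
Qed.

Let powR_ratio_le : q `^ gamma <= Num.sqrt q.
Proof.
have q01 := spectral_ratio; have /andP[q0 q1] := q01.
by rewrite -powR12_sqrt ?(ltW q0) // ger_powR.
Qed.

(** [q ^ gamma <= sqrt q <= (1 + q) / 2], by the inequality of the means. *)
Lemma sift_residual_ge :
  alpha / (2 * (s ^+ 2 + alpha)) <= sift_residual gamma alpha s.
Proof.
have /andP[q0 q1] := spectral_ratio.
have -> : alpha / (2 * (s ^+ 2 + alpha)) = (1 - q) / 2.
  by rewrite one_minus_ratio; field; rewrite gt_eqF.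
rewrite /sift_residual -/q; have := powR_ratio_le.
have : Num.sqrt q ^+ 2 = q by rewrite sqr_sqrtr // ltW.
by have := sqr_ge0 (Num.sqrt q - 1); nra.
Qed.

Lemma sift_filter_ge0_le1 n : 0 <= sift_filter gamma n alpha s <= 1.
Proof.
have /andP[r0 r1] := sift_residual_ge0_le1.
by rewrite sift_filterE subr_ge0 exprn_ile1 //= lerBlDr lerDl exprn_ge0.
Qed.

(** The noise bound: [1 - r ^ n <= n (1 - r) = n q ^ gamma <= n sqrt q], and
    [sqrt q <= s / sqrt alpha].  The exponent [1 / 2] is the smallest [gamma] for
    which one factor [s] is gained. *)
Lemma sift_filter_div_le n :
  `|sift_filter gamma n alpha s * s^-1| <= n%:R * (Num.sqrt alpha)^-1.
Proof.
have /andP[r0 r1] := sift_residual_ge0_le1.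
have /andP[F0 F1] := sift_filter_ge0_le1 n.
rewrite ger0_norm; last by apply: mulr_ge0; rewrite ?invr_ge0 ?(ltW s_gt0).
rewrite ler_pdivrMr // -mulrA sift_filterE.
apply: le_trans (bernoulli n sift_residual_ge0_le1) _.
rewrite ler_wpM2l // /sift_residual opprB addrC subrK -/q.
apply: le_trans powR_ratio_le _.
rewrite /q sqrtrM ?sqr_ge0 // sqrtr_sqr gtr0_norm // mulrC sqrtrV ?(ltW A_gt0) //.
rewrite ler_wpM2r ?(ltW s_gt0) // lef_pV2 ?posrE ?sqrtr_gt0 //.
by rewrite ler_wsqrtr // lerDr sqr_ge0.
Qed.

(** With [A = s ^ 2 + alpha], up to the constant the left side is at most
    [(s ^ 2) ^ (nu / 2) (alpha / A) ^ n]; since [alpha / A <= 1], the exponent [n]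
    can be lowered to [nu / 2], and [s ^ 2 <= A] makes the powers of [A] cancel.
    This is where the qualification [nu <= 2 n] enters. *)
Lemma powR_mul_sift_residual_le n N nu : gamma <= N%:R ->
  0 < nu -> nu <= (2 * n)%:R ->
  `|s `^ nu * sift_residual gamma alpha s ^+ n|
    <= N%:R ^+ n * alpha `^ (nu / 2).
Proof.
move=> gN nu0 nun; have /andP[r0 r1] := sift_residual_ge0_le1.
rewrite ger0_norm ?mulr_ge0 ?powR_ge0 ?exprn_ge0 //.
set A := s ^+ 2 + alpha.
have rn : sift_residual gamma alpha s ^+ n <= N%:R ^+ n * (alpha / A) ^+ n.
  rewrite -exprMn lerXn2r ?nnegrE ?sift_residual_le //.
  by rewrite mulr_ge0 // divr_ge0 ?ltW.
apply: le_trans (ler_wpM2l (powR_ge0 _ _) rn) _.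
rewrite mulrCA ler_wpM2l ?exprn_ge0 //.
have aA : 0 <= alpha / A by rewrite divr_ge0 ?ltW.
have aA1 : alpha / A <= 1 by rewrite ler_pdivrMr // mul1r lerDr sqr_ge0.
have aA0 : 0 < alpha / A by rewrite divr_gt0.
have nuE : nu = 2 * (nu / 2) by lra.
rewrite {1}nuE powR_sqr ?(ltW s_gt0) // -[(_ / _) ^+ n]powR_mulrn //.
apply: (@le_trans _ _ (A `^ (nu / 2) * (alpha / A) `^ (nu / 2))).
  apply: ler_pM; rewrite ?powR_ge0 //.
    rewrite ge0_ler_powR ?nnegrE ?sqr_ge0 ?(ltW A_gt0) //; first by lra.
    by rewrite lerDl ltW.
  rewrite ger_powR ?aA0 //; rewrite natrM in nun; lra.
rewrite -powRM ?(ltW A_gt0) // (_ : A * _ = alpha) //.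
by field; rewrite gt_eqF.
Qed.

End Residual.

(** Squeezed between [1] and [1 - r >= 1 - N alpha / s ^ 2]. *)
Lemma sift_filter_cvg1 gamma n s : 1 / 2 <= gamma -> (1 <= n)%N -> 0 < s ->
  sift_filter gamma n alpha s @[alpha --> 0^'+] --> (1 : R).
Proof.
move=> gamma_ge n1 s0.
pose N := (Num.trunc gamma).+1.
have gN : gamma <= N%:R by rewrite ltW // truncnS_gt.
apply: (@squeeze_cvgr _ _ _ _ (fun alpha => 1 - N%:R / s ^+ 2 * alpha) (cst 1)).
- near=> alpha.
  have a0 : 0 < alpha by near: alpha; exact: nbhs_right_gt.
  have /andP[_ ->] := sift_filter_ge0_le1 gamma_ge a0 s0 n; rewrite andbT.
  have r01 := sift_residual_ge0_le1 gamma_ge a0 s0.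
  have /andP[r0 r1] := r01.
  rewrite sift_filterE // lerB //; apply: (@le_trans _ _ (sift_residual gamma alpha s)).
    by rewrite -{2}[sift_residual _ _ _]expr1 ler_wiXn2l.
  apply: le_trans (sift_residual_le a0 s0 gN) _.
  rewrite -mulrA ler_wpM2l // mulrC ler_wpM2r ?(ltW a0) //.
  by rewrite lef_pV2 ?posrE ?addr_gt0 ?exprn_gt0 // lerDl ltW.
- rewrite -[X in _ --> X]subr0 -[X in _ --> _ - X](mulr0 (N%:R / s ^+ 2)).
  apply: cvgB; first exact: cvg_cst.
  apply: cvgM; first exact: cvg_cst.
  exact: cvg_at_right_filter.
- exact: cvg_cst.
Unshelve. all: by end_near. Qed.

Lemma measurable_sift_filter gamma n alpha :
  @measurable_fun _ _ (measurableTypeR R) (measurableTypeR R)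
    `[0, +oo[%classic (sift_filter gamma n alpha).
Proof.
apply: (@measurable_funS _ _ _ _ setT) => //.
have powm p : measurable_fun [set: measurableTypeR R]
    (fun s : measurableTypeR R => ((s ^+ 2 + alpha) `^ p : measurableTypeR R)).
  apply: (measurableT_comp (measurable_powR p)).
  by apply: measurable_funD => //; exact: measurable_funX.
rewrite /sift_filter; apply: measurable_funM.
  apply: measurable_funB; first exact: powm.
  apply: measurable_funX; apply: measurable_funB; first exact: powm.
  exact: measurable_powR.
under eq_fun do rewrite -powRN.
exact: powm.
Qed.

End ScalarEstimates.

(** * Functional calculus *)

Section Spectral.
Context (R : realType) (k : scalars) (X Y : hilbertSpace R k).
Context (K : {linear X -> Y}) (Kadj : Y -> X) (K_adj : is_adjoint K Kadj).
Context (S : sing_val_exp K Kadj).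
Local Notation C := (scal R k).
Local Notation "r %:K" := (of_real k r) (at level 1, format "r %:K").
Local Notation I := (sve_idx S).
Local Notation v := (vvec S).
Local Notation u := (uvec S).
Local Notation expandsX := (expands_to I v).

Let v_on m p : I m -> I p -> ip (v m) (v p) = (m == p)%:R.
Proof. by case: (sve_v S) => _ + _; apply. Qed.

Let u_on m p : I m -> I p -> ip (u m) (u p) = (m == p)%:R.
Proof. by case: (sve_u S) => _ + _; apply. Qed.

Definition bounded_on_spectrum (b : nat -> R) :=
  exists M, forall m, I m -> `|b m| <= M.

(** The singular values are bounded by the first one. *)
Lemma nondecreasing_bounded_on_spectrum (f : R -> R) :
  (forall s, 0 <= s -> 0 <= f s) ->
  (forall s t, 0 <= s -> s <= t -> f s <= f t) ->
  bounded_on_spectrum (fun m => f (sv S m)).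
Proof.
move=> f_ge0 f_nd; exists (f (sv S 0)) => m Im.
have s0 : 0 <= sv S m by rewrite ltW // sv_gt0.
by rewrite ger0_norm ?f_ge0 // f_nd // sv_noninc.
Qed.

Lemma ip_v_expands (x : X) :
  exists p, expandsX (fun m => ip x (v m)) p.
Proof. exact: l2_bounded_cvg (bessel_l2 v_on x). Qed.

Lemma multiplier_expands (b : nat -> R) (a : nat -> C) (B : R) :
  bounded_on_spectrum b -> l2_bounded I a B ->
  exists z, expandsX (fun m => (b m)%:K * a m) z.
Proof.
by move=> [M bM] aB; apply: l2_bounded_cvg (l2_multiplier bM aB).
Qed.

Lemma sve_sumE (a : nat -> C) x : expandsX a x ->
  sve_sum S (fun m => a m *: v m) = x.
Proof. exact: expands_lim. Qed.

Section FunctionalCalculus.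
Variable phi : R -> R.
Hypothesis phi_bounded : bounded_on_spectrum (fun m => phi (sv S m ^+ 2)).

(** An expansion in the [v m] has no component in the kernel of K, so the second
    summand of the functional calculus vanishes. *)
Lemma fun_KadjK_expands a x : expandsX a x ->
  expandsX (fun m => (phi (sv S m ^+ 2))%:K * a m) (fun_KadjK S phi x).
Proof.
move=> ax; have [z az] := multiplier_expands phi_bounded (expands_l2 v_on ax).
have ipE m : I m -> a m = ip x (v m) by move=> Im; rewrite (expands_ip v_on ax Im).
rewrite /fun_KadjK (sve_sumE (eq_expands ipE ax)) subrr scaler0 addr0.
rewrite (@sve_sumE (fun m => (phi (sv S m ^+ 2))%:K * ip x (v m)) z) //.
by apply: eq_expands az => m /ipE ->.
Qed.

Lemma fun_KadjK_ip x m : I m ->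
  ip (fun_KadjK S phi x) (v m) = (phi (sv S m ^+ 2))%:K * ip x (v m).
Proof.
move=> Im; have [p xp] := ip_v_expands x.
have [z xz] := multiplier_expands phi_bounded (bessel_l2 v_on x).
rewrite /fun_KadjK (sve_sumE xp) (sve_sumE xz) ipDl ipZl ipBl.
by rewrite (expands_ip v_on xp Im) subrr mulr0 addr0 (expands_ip v_on xz Im).
Qed.

(** The coefficients along the [v m] are multiplied by nonzero factors, hence
    determined; once they agree, so do both sums in the functional calculus, and
    [phi 0 != 0] takes care of the component in the kernel. *)
Lemma fun_KadjK_inj : (forall t, 0 <= t -> phi t != 0) ->
  injective (fun_KadjK S phi).
Proof.
move=> phi0 x y xy.
have ipE m : I m -> ip x (v m) = ip y (v m).
  move=> Im; apply: (@mulfI _ (phi (sv S m ^+ 2))%:K).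
    by rewrite fmorph_eq0 phi0 ?sqr_ge0.
  by rewrite -!fun_KadjK_ip // xy.
have sumE (b : nat -> C) : sve_sum S (fun m => (b m * ip x (v m)) *: v m)
                         = sve_sum S (fun m => (b m * ip y (v m)) *: v m).
  congr (limn _); apply/funext => N; apply: eq_bigr => m /set_mem Im.
  by rewrite ipE.
have sumE1 : sve_sum S (fun m => ip x (v m) *: v m)
           = sve_sum S (fun m => ip y (v m) *: v m).
  congr (limn _); apply/funext => N; apply: eq_bigr => m /set_mem Im.
  by rewrite ipE.
move: xy; rewrite /fun_KadjK sumE sumE1 => /addrI.
move=> /(scalerI _) /addIr; apply.
by rewrite fmorph_eq0 phi0.
Qed.

(** The case of positive powers: the component of [x] in the kernel of K is
    annihilated, so [x] need not be an expansion itself. *)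
Lemma fun_KadjK_range x : phi 0 = 0 ->
  expandsX (fun m => (phi (sv S m ^+ 2))%:K * ip x (v m)) (fun_KadjK S phi x).
Proof.
move=> phi0; have [z xz] := multiplier_expands phi_bounded (bessel_l2 v_on x).
by rewrite /fun_KadjK phi0 rmorph0 scale0r addr0 (sve_sumE xz).
Qed.

End FunctionalCalculus.

Lemma powR_bounded_on_spectrum (alpha p : R) : 0 <= alpha -> 0 <= p ->
  bounded_on_spectrum (fun m => (sv S m ^+ 2 + alpha) `^ p).
Proof.
move=> a0 p0.
apply: (@nondecreasing_bounded_on_spectrum (fun s => (s ^+ 2 + alpha) `^ p)).
  by move=> s _; rewrite powR_ge0.
move=> s t s0 st; have t0 := le_trans s0 st.
rewrite ge0_ler_powR ?nnegrE ?addr_ge0 ?sqr_ge0 // lerD2r.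
by rewrite ler_pXn2r ?nnegrE.
Qed.

Lemma powR0_bounded_on_spectrum (p : R) : 0 <= p ->
  bounded_on_spectrum (fun m => (sv S m ^+ 2) `^ p).
Proof.
move=> p0; have [M HM] := powR_bounded_on_spectrum (lexx 0) p0.
by exists M => m /HM; rewrite addr0.
Qed.

Lemma ip_Ku x m : I m -> ip (K x) (u m) = (sv S m)%:K * ip x (v m).
Proof.
move=> Im; rewrite K_adj (sve_Kadju Im) ip_conj ipZl rmorphM /= conj_of_real.
by rewrite -ip_conj.
Qed.

(** On attainable data the pseudo-inverse returns the projection of [x] onto the
    orthogonal complement of the kernel of K. *)
Lemma pseudo_inv_expands x :
  expandsX (fun m => ip x (v m)) (pseudo_inv S (K x)).
Proof.
have [p xp] := ip_v_expands x; rewrite /pseudo_inv.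
rewrite (@sve_sumE (fun m => (sv S m)^-1%:K * ip (K x) (u m)) p) //.
apply: eq_expands xp => m Im; rewrite ip_Ku // mulrA -rmorphM /= mulVf.
  by rewrite rmorph1 mul1r.
by rewrite gt_eqF // sv_gt0.
Qed.

(** * The iterates *)

Section Iterates.
Variables (gamma : R).
Hypothesis (gamma_ge : 1 / 2 <= gamma).

Let gamma_gt0 : 0 < gamma.
Proof. by apply: lt_le_trans gamma_ge; rewrite divr_gt0. Qed.

Lemma pow_KadjK_Kadj_expands y :
  expandsX (fun m => (sv S m `^ (2 * gamma - 1))%:K * ip y (u m))
           (pow_KadjK_Kadj S gamma y).
Proof.
have [|z yz] := @multiplier_expands (fun m => sv S m `^ (2 * gamma - 1))
    (fun m => ip y (u m)) (rnorm y) _ (bessel_l2 u_on y).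
  have g0 : 0 <= 2 * gamma - 1 by move: gamma_ge; lra.
  apply: (@nondecreasing_bounded_on_spectrum (fun s => s `^ (2 * gamma - 1))).
    by move=> s _; rewrite powR_ge0.
  by move=> s t s0 st; rewrite ge0_ler_powR ?nnegrE // (le_trans s0).
by rewrite /pow_KadjK_Kadj (sve_sumE yz).
Qed.

(** The expansion on the right exists by the noise bound.  It solves the step
    equation because, with [r] the residual of one step,
    [(s ^ 2 + alpha) ^ gamma (1 - r ^ n.+1)
       = s ^ (2 gamma) + ((s ^ 2 + alpha) ^ gamma - s ^ (2 gamma)) (1 - r ^ n)],
    and injectivity of [(K^*K + alpha) ^ gamma] makes it the chosen iterate. *)
Lemma sift_expands n (alpha : R) y : 0 < alpha ->
  expandsX (fun m => (sift_filter gamma n alpha (sv S m) * (sv S m)^-1)%:K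
                       * ip y (u m)) (sift S gamma n alpha y).
Proof.
move=> a0; elim: n => [|n IH].
  apply: eq_expands (expands0 I v) => m Im.
  by rewrite sift_filterE ?sv_gt0 // expr0 subrr mul0r rmorph0 mul0r.
set phi := fun t : R => (t + alpha) `^ gamma.
have phiB : bounded_on_spectrum (fun m => phi (sv S m ^+ 2)).
  exact: powR_bounded_on_spectrum (ltW a0) (ltW gamma_gt0).
have psiB : bounded_on_spectrum (fun m => (fun t => t `^ gamma) (sv S m ^+ 2)).
  exact: powR0_bounded_on_spectrum (ltW gamma_gt0).
(* [z] is the candidate for the next iterate. *)
have [z Hz] : exists z, expandsX
   (fun m => (sift_filter gamma n.+1 alpha (sv S m) * (sv S m)^-1)%:K
                       * ip y (u m)) z.
  apply: multiplier_expands (bessel_l2 u_on y).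
  exists (n.+1%:R * (Num.sqrt alpha)^-1) => m Im.
  by apply: sift_filter_div_le => //; exact: sv_gt0.
suff -> : sift S gamma n.+1 alpha y = z by [].
rewrite /sift iterS -/(sift S gamma n alpha y).
set E := [set x | _].
have Ez : E z.
  rewrite /E /= /sift_equation -/phi.
  apply: expands_uniq (@fun_KadjK_expands phi phiB _ _ Hz) _.
  have := expandsD (@pow_KadjK_Kadj_expands y)
    (expandsB (@fun_KadjK_expands phi phiB _ _ IH)
      (@fun_KadjK_expands (fun t => t `^ gamma) psiB _ _ IH)).
  apply: eq_expands => m Im /=; have s0 := sv_gt0 Im.
  rewrite !sift_filterE // !mulrA -!rmorphM /= -mulrBl -rmorphB -mulrDl.
  rewrite -rmorphD /=; congr (_%:K * _); rewrite !mulrA -mulrBl.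
  rewrite powRB; last by apply/implyP => _; rewrite gt_eqF.
  rewrite powRr1 ?(ltW s0) // -mulrDl.
  congr (_ / _); rewrite /phi powR_sqr ?(ltW s0) // [_ ^+ n.+1]exprS.
  set r := sift_residual _ _ _ ^+ n; rewrite /sift_residual.
  rewrite powR_div ?sqr_ge0 ?addr_ge0 ?sqr_ge0 ?(ltW a0) //.
  have A0 : (sv S m ^+ 2 + alpha) `^ gamma != 0.
    by rewrite gt_eqF // powR_gt0 // addr_gt0 ?exprn_gt0.
  by field.
apply: (@fun_KadjK_inj phi) => //.
  by move=> t t0; rewrite gt_eqF // powR_gt0 // ltr_wpDl.
have /= -> := xgetPex 0 (ex_intro _ z Ez).
by rewrite [RHS]Ez.
Qed.

Lemma sift_rnorm_le n (alpha : R) y y' : 0 < alpha ->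
  rnorm (sift S gamma n alpha y - sift S gamma n alpha y')
    <= n%:R * (Num.sqrt alpha)^-1 * rnorm (y - y').
Proof.
move=> a0; apply: (@expands_rnorm_le _ _ _ _ _ v_on
    (fun m => (sift_filter gamma n alpha (sv S m) * (sv S m)^-1)%:K
                * ip (y - y') (u m))).
- by rewrite mulr_ge0 ?rnorm_ge0 // mulr_ge0 // invr_ge0 sqrtr_ge0.
- apply: eq_expands (expandsB (@sift_expands n alpha y a0) (@sift_expands n alpha y' a0)).
  by move=> m Im; rewrite ipBl mulrBr.
- apply: l2_multiplier (bessel_l2 u_on _) => m Im.
  by apply: sift_filter_div_le => //; exact: sv_gt0.
Qed.

Lemma sift_error_expands n (alpha : R) x : 0 < alpha ->
  expandsX (fun m => (sift_residual gamma alpha (sv S m) ^+ n)%:K * ip x (v m))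
    (pseudo_inv S (K x) - sift S gamma n alpha (K x)).
Proof.
move=> a0.
apply: eq_expands (expandsB (@pseudo_inv_expands x) (@sift_expands n alpha (K x) a0)).
move=> m Im; have s0 := sv_gt0 Im; rewrite ip_Ku // mulrA -rmorphM /=.
rewrite -mulrA mulVf ?gt_eqF // mulr1 sift_filterE // rmorphB rmorph1 /=.
by rewrite mulrBl mul1r opprB addrC subrK.
Qed.

Lemma sift_error_source_le n N (nu rho alpha : R) x : 0 < alpha ->
  gamma <= N%:R -> 0 < nu -> nu <= (2 * n)%:R ->
  source_ball S nu rho (pseudo_inv S (K x)) ->
  rnorm (pseudo_inv S (K x) - sift S gamma n alpha (K x))
    <= N%:R ^+ n * alpha `^ (nu / 2) * rho.
Proof.
move=> a0 gN nu0 nun [w [xE wrho]].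
have nu20 : 0 < nu / 2 by rewrite divr_gt0.
have B := powR0_bounded_on_spectrum (ltW nu20).
have Hw := @fun_KadjK_range (fun t => t `^ (nu / 2)) B w (powR0 (lt0r_neq0 nu20)).
apply: (@le_trans _ _ (N%:R ^+ n * alpha `^ (nu / 2) * rnorm w)); last first.
  by rewrite ler_wpM2l // mulr_ge0 ?exprn_ge0 ?powR_ge0.
apply: (@expands_rnorm_le _ _ _ _ _ v_on (fun m =>
    (sv S m `^ nu * sift_residual gamma alpha (sv S m) ^+ n)%:K * ip w (v m))).
- by rewrite mulr_ge0 ?rnorm_ge0 // mulr_ge0 ?exprn_ge0 ?powR_ge0.
- apply: eq_expands (@sift_error_expands n alpha x a0) => m Im.
  rewrite -(expands_ip v_on (@pseudo_inv_expands x) Im) xE.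
  rewrite (expands_ip v_on Hw Im) mulrA -rmorphM /= -powR_sqr ?(ltW (sv_gt0 Im)) //.
  by rewrite [2 * _]mulrC divfK ?pnatr_eq0 // [_ `^ _ * _]mulrC.
- apply: l2_multiplier (bessel_l2 v_on _) => m Im.
  by apply: powR_mul_sift_residual_le => //; exact: sv_gt0.
Qed.

End Iterates.
End Spectral.

(** * Optimal order and saturation *)

Section Rates.
Context (R : realType) (k : scalars) (X Y : hilbertSpace R k).
Context (K : {linear X -> Y}) (Kadj : Y -> X) (K_adj : is_adjoint K Kadj).
Context (S : sing_val_exp K Kadj).
Local Notation "r %:K" := (of_real k r) (at level 1, format "r %:K").
Local Notation I := (sve_idx S).
Local Notation v := (vvec S).
Variables (gamma : R) (n : nat).
Hypothesis gamma_ge : 1 / 2 <= gamma.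

Let v_on m p : I m -> I p -> ip (v m) (v p) = (m == p)%:R.
Proof. by case: (sve_v S) => _ + _; apply. Qed.

(** The a priori choice equates the approximation and noise bounds. *)
Lemma parameter_choiceE (nu delta rho : R) : 0 < nu -> 0 < delta -> 0 < rho ->
  let alpha := (delta / rho) `^ (2 / (nu + 1)) in
  alpha `^ (nu / 2) * rho = delta `^ (nu / (nu + 1)) * rho `^ (1 / (nu + 1)) /\
  (Num.sqrt alpha)^-1 * delta
    = delta `^ (nu / (nu + 1)) * rho `^ (1 / (nu + 1)).
Proof.
move=> nu0 d0 r0 /=.
have nu1 : nu + 1 != 0 by rewrite gt_eqF // addr_gt0.
have pow1 (t a b : R) : 0 < t -> a + b = 1 -> t `^ a * t `^ b = t.
  by move=> t0 ab; rewrite -powRD ?ab ?powRr1 ?(ltW t0) // gt_eqF ?implybT.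
have dr0 : 0 <= delta / rho by rewrite divr_ge0 ?(ltW d0) ?(ltW r0).
have sum1 : nu / (nu + 1) + 1 / (nu + 1) = 1 by field.
split.
  rewrite -powRrM (_ : 2 / (nu + 1) * (nu / 2) = nu / (nu + 1)); last by field.
  rewrite powR_div ?(ltW d0) ?(ltW r0) // -[X in _ / _ * X](pow1 rho _ _ r0 sum1).
  by field; rewrite gt_eqF // powR_gt0.
rewrite -powR12_sqrt ?powR_ge0 // -powRrM.
rewrite (_ : 2 / (nu + 1) * 2^-1 = 1 / (nu + 1)); last by field.
rewrite powR_div ?(ltW d0) ?(ltW r0) // -[X in _ * X = _](pow1 delta _ _ d0 sum1).
by field; rewrite !gt_eqF // powR_gt0.
Qed.

(** The constant is [N ^ n + n], with [N] an integer above [gamma]: it depends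
    neither on [nu] nor on the data. *)
Lemma sift_noisy_error_le : exists c : R, forall (nu delta rho : R) x yd,
  0 < nu -> nu <= (2 * n)%:R -> 0 < delta -> 0 < rho ->
  source_ball S nu rho (pseudo_inv S (K x)) -> rnorm (K x - yd) <= delta ->
  rnorm (pseudo_inv S (K x)
         - sift S gamma n ((delta / rho) `^ (2 / (nu + 1))) yd)
    <= c * delta `^ (nu / (nu + 1)) * rho `^ (1 / (nu + 1)).
Proof.
pose N := (Num.trunc gamma).+1.
have gN : gamma <= N%:R by rewrite ltW // truncnS_gt.
exists (N%:R ^+ n + n%:R) => nu delta rho x yd nu0 nun d0 r0 xnu yyd.
have a0 : 0 < (delta / rho) `^ (2 / (nu + 1)) by rewrite powR_gt0 // divr_gt0.
have [] := parameter_choiceE nu0 d0 r0.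
set alpha := _ `^ (2 / (nu + 1)) in a0 *; rewrite -mulrA.
set D := _ * _ `^ (1 / _) => alphaD sqrtD.
rewrite -(subrKA (sift S gamma n alpha (K x))) mulrDl.
apply: le_trans (ler_rnormD _ _) (lerD _ _).
  rewrite -alphaD mulrA.
  exact (sift_error_source_le K_adj gamma_ge a0 gN nu0 nun xnu).
apply: le_trans (sift_rnorm_le S gamma_ge n (K x) yd a0) _.
by rewrite -sqrtD mulrA ler_wpM2l // mulr_ge0 // invr_ge0 sqrtr_ge0.
Qed.

Lemma sift_optimal_order_with (nu : R) : 0 < nu -> nu <= (2 * n)%:R ->
  optimal_order_with S +oo%E (sift S gamma n) nu
    (fun delta rho => (delta / rho) `^ (2 / (nu + 1))).
Proof.
move=> nu0 nun; have [c Hc] := sift_noisy_error_le.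
exists c => delta rho d0 r0; split.
- by rewrite powR_gt0 // divr_gt0.
- by rewrite ltry.
- apply: ge_ereal_sup => _ [y [yd [[x _ <-] xnu yyd ->]]].
  by rewrite lee_fin Hc.
Qed.

Lemma sift_filter_regularization : (1 <= n)%N ->
  filter_regularization S +oo%E (sift_filter gamma n) (sift S gamma n).
Proof.
move=> n1; split=> //.
- move=> alpha a0 _; split; first exact: measurable_sift_filter.
    exists (n%:R * (Num.sqrt alpha)^-1) => m Im.
    exact (sift_filter_div_le gamma_ge a0 (sv_gt0 Im) n).
  by move=> y; exact (sift_expands gamma_ge (n := n) (y := y) a0).
- exists 1 => alpha m a0 _ Im.
  have /andP[F0 F1] := sift_filter_ge0_le1 gamma_ge a0 (sv_gt0 Im) n.
  by rewrite ger0_norm.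
- by move=> m Im; exact (sift_filter_cvg1 gamma_ge n1 (sv_gt0 Im)).
Qed.

Lemma near0_le_singular_values N :
  \forall alpha \near 0^'+, forall m, (m < N)%N -> I m -> alpha <= sv S m ^+ 2.
Proof.
elim: N => [|N IH]; first exact: nearW.
have [IN|nIN] := pselect (I N); last first.
  apply: filterS IH => alpha H m; rewrite ltnS leq_eqVlt => /predU1P[-> //|].
  exact: H.
near=> alpha => m; rewrite ltnS leq_eqVlt => /predU1P[->|mN].
  by move=> _; near: alpha; apply: nbhs_right_le; rewrite exprn_gt0 ?sv_gt0.
by move: m mN; near: alpha.
Unshelve. all: by end_near. Qed.

(** Once [alpha] is below [s ^ 2], the bound [alpha / (2 (s ^ 2 + alpha))] on the
    residual is at least [alpha / (4 s ^ 2)]. *)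
Lemma sift_residual_ge_small alpha s : 0 < alpha -> alpha <= s ^+ 2 -> 0 < s ->
  (s ^+ 2)^-1 ^+ n
    <= (4 / alpha) ^+ n * sift_residual gamma alpha s ^+ n.
Proof.
move=> a0 as2 s0; rewrite -exprMn; apply: lerXn2r.
- by rewrite nnegrE invr_ge0 sqr_ge0.
- rewrite nnegrE mulr_ge0 ?divr_ge0 ?(ltW a0) //.
  by have /andP[] := sift_residual_ge0_le1 gamma_ge a0 s0.
have s20 : 0 < s ^+ 2 by rewrite exprn_gt0.
have h := sift_residual_ge gamma_ge a0 s0.
have {}h := ler_wpM2l (divr_ge0 (ler0n R 4) (ltW a0)) h.
apply: le_trans h.
have -> : 4 / alpha * (alpha / (2 * (s ^+ 2 + alpha))) = ((s ^+ 2 + alpha) / 2)^-1.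
  by field; rewrite !gt_eqF // addr_gt0.
rewrite lef_pV2 ?posrE ?divr_gt0 ?addr_gt0 //.
by rewrite ler_pdivrMr // mulr_natr mulr2n lerD2l.
Qed.

(** Saturation.  For each finite set of indices, one suitably small [alpha] turns
    the error bound into a bound on the squared sum of
    [sigma ^ (- 2 n) <x, v_m>], and the powers of [alpha] cancel, so that the
    bound [4 ^ n * C0] does not depend on the set. *)
Lemma source_space_of_rate x C0 : 0 <= C0 ->
  (\forall alpha \near 0^'+,
     rnorm (pseudo_inv S (K x) - sift S gamma n alpha (K x)) <= C0 * alpha ^+ n) ->
  source_space S (2 * n)%:R (pseudo_inv S (K x)).
Proof.
move=> C0_ge0 rate.
pose a m := ((sv S m ^+ 2)^-1 ^+ n)%:K * ip x (v m).
have aB : l2_bounded I a (4 ^+ n * C0).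
  move=> N; near (0 : R)^'+ => alpha.
  have a0 : 0 < alpha by near: alpha; exact: nbhs_right_gt.
  have aS : forall m, (m < N)%N -> I m -> alpha <= sv S m ^+ 2.
    by near: alpha; exact: near0_le_singular_values.
  have aE : rnorm (pseudo_inv S (K x) - sift S gamma n alpha (K x))
              <= C0 * alpha ^+ n by near: alpha.
  have an0 : alpha ^+ n != 0 by rewrite expf_neq0 // gt_eqF.
  have := expands_l2 v_on (sift_error_expands K_adj gamma_ge (n := n) (x := x) a0) N.
  set err := rnorm _ in aE *; move=> errB.
  apply: (@le_trans _ _ (((4 / alpha) ^+ n) ^+ 2 * err ^+ 2)).
    apply: le_trans (ler_wpM2l (sqr_ge0 _) errB); rewrite mulr_sumr.
    rewrite big_nat_cond [leRHS]big_nat_cond; apply: ler_sum.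
    move=> m /andP[/andP[_ mN] /set_mem Im]; have s0 := sv_gt0 Im.
    rewrite /a !rabsM !rabs_of_real -exprMn mulrA ler_pXn2r ?nnegrE.
    - rewrite ler_wpM2r ?rabs_ge0 // !ger0_norm.
      + exact (sift_residual_ge_small a0 (aS m mN Im) s0).
      + by rewrite exprn_ge0; have /andP[] := sift_residual_ge0_le1 gamma_ge a0 s0.
      + by rewrite exprn_ge0 // invr_ge0 sqr_ge0.
    - by [].
    - by rewrite mulr_ge0 ?rabs_ge0.
    - by rewrite mulr_ge0 ?rabs_ge0 // mulr_ge0 // exprn_ge0 // divr_ge0 // ltW.
  rewrite -exprMn ler_pXn2r ?nnegrE.
  - rewrite expr_div_n -mulrA ler_wpM2l ?exprn_ge0 // mulrC.
    by rewrite ler_pdivrMr ?exprn_gt0.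
  - by [].
  - by rewrite mulr_ge0 ?rnorm_ge0 // exprn_ge0 // divr_ge0 // ltW.
  - by rewrite mulr_ge0 // exprn_ge0.
have [w aw] := l2_bounded_cvg v_on aB.
(* A source ball has positive radius, and [w] may vanish. *)
exists (rnorm w + 1); split; first by rewrite ltr_wpDl ?rnorm_ge0.
exists w; split; last by rewrite lerDl.
pose phi (t : R) : R := t `^ ((2 * n)%:R / 2).
have phiB : bounded_on_spectrum S (fun m => phi (sv S m ^+ 2)).
  by apply: powR0_bounded_on_spectrum; rewrite divr_ge0.
apply: expands_uniq (@pseudo_inv_expands _ _ _ _ _ _ K_adj S x) _.
apply: eq_expands (fun_KadjK_expands phiB aw) => m Im.
have s0 := sv_gt0 Im.
have nE : (2 * n)%:R / 2 = n%:R :> R by rewrite natrM mulrC mulKf ?pnatr_eq0.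
rewrite /a mulrA -rmorphM /= /phi nE.
rewrite powR_mulrn ?sqr_ge0 // -exprMn divff ?expf_neq0 ?gt_eqF //.
by rewrite expr1n rmorph1 mul1r.
Unshelve. all: by end_near. Qed.

End Rates.

Theorem proposition18 (R : realType) (k : scalars) (X Y : hilbertSpace R k)
    (K : {linear X -> Y}) (K_compact : compact_operator K)
    (Kadj : Y -> X) (K_adj : is_adjoint K Kadj) (S : sing_val_exp K Kadj)
    (n : nat) (n_ge1 : (1 <= n)%N) (gamma : R) (gamma_ge : 1 / 2 <= gamma) :
  [/\ filter_regularization S +oo%E (sift_filter gamma n) (sift S gamma n),
      forall nu : R, 0 < nu -> nu <= (2 * n)%:R ->
        optimal_order S +oo%E (sift S gamma n) nu,
      let rates := [set r : R | exists nu : R, [/\ 0 < nu, nu <= (2 * n)%:R,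
                      optimal_order S +oo%E (sift S gamma n) nu &
                      r = nu / (nu + 1)]] in
        rates ((2 * n)%:R / (2 * n + 1)%:R) /\
        ubound rates ((2 * n)%:R / (2 * n + 1)%:R),
      optimal_order_with S +oo%E (sift S gamma n) (2 * n)%:R
          (fun delta rho => (delta / rho) `^ (2 / (2 * n + 1)%:R)) /\
        (forall (rho : R) (y : Y) (yd : R -> Y), 0 < rho -> range K y ->
          source_ball S (2 * n)%:R rho (pseudo_inv S y) ->
          (forall delta : R, 0 < delta -> rnorm (y - yd delta) <= delta) ->
          (fun delta : R => rnorm (pseudo_inv S y
             - sift S gamma n ((delta / rho) `^ (2 / (2 * n + 1)%:R))
                 (yd delta)) : R^o)
          =O_ (0^'+)
          (fun delta : R => delta `^ ((2 * n)%:R / (2 * n + 1)%:R) : R^o)) &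
      forall y : Y, range K y ->
        (fun alpha : R => rnorm (pseudo_inv S y - sift S gamma n alpha y) : R^o)
          =O_ (0^'+) (fun alpha : R => alpha ^+ n : R^o) ->
        source_space S (2 * n)%:R (pseudo_inv S y)].
Proof.
have nn0 : 0 < (2 * n)%:R :> R by rewrite ltr0n muln_gt0.
have optimal (nu : R) : 0 < nu -> nu <= (2 * n)%:R ->
    optimal_order S +oo%E (sift S gamma n) nu.
  move=> nu0 nun; eexists.
  exact (sift_optimal_order_with K_adj S gamma_ge nu0 nun).
rewrite natrD; split.
- exact: sift_filter_regularization.
- exact: optimal.
- split; first by exists (2 * n)%:R; split=> //; exact: optimal.
  move=> _ [nu [nu0 nun _ ->]].
  rewrite ler_pdivrMr ?addr_gt0 // mulrAC ler_pdivlMr ?addr_gt0 //.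
  by rewrite !mulrDr !mulr1 [nu * _]mulrC lerD2l.
- split; first exact (sift_optimal_order_with K_adj S gamma_ge nn0 (lexx _)).
  move=> rho _ yd r0 [x _ <-] xnu Hyd.
  have [c Hc] := sift_noisy_error_le K_adj S n gamma_ge.
  (* The added 1 only makes the constant positive. *)
  apply/eqO_exP; exists (`|c| * rho `^ (1 / ((2 * n)%:R + 1)) + 1).
    by rewrite ltr_wpDl ?mulr_ge0 ?powR_ge0.
  near=> delta.
  have d0 : 0 < delta by near: delta; exact: nbhs_right_gt.
  rewrite (ger0_norm (rnorm_ge0 _)) (ger0_norm (powR_ge0 _ _)).
  apply: le_trans (Hc _ _ _ _ _ nn0 (lexx _) d0 r0 xnu (Hyd _ d0)) _.
  rewrite mulrAC ler_wpM2r ?powR_ge0 // //.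
  apply: (@le_trans _ _ (`|c| * rho `^ (1 / ((2 * n)%:R + 1)))).
    by rewrite ler_wpM2r ?powR_ge0 ?ler_norm.
  by rewrite lerDl.
- move=> _ [x _ <-] /eqO_exP [C0 C0_gt0 rate].
  apply: (source_space_of_rate K_adj gamma_ge (ltW C0_gt0)).
  near=> alpha.
  have a0 : 0 < alpha by near: alpha; exact: nbhs_right_gt.
  have : `|rnorm (pseudo_inv S (K x) - sift S gamma n alpha (K x))|
           <= C0 * `|alpha ^+ n| by near: alpha.
  by rewrite !ger0_norm ?rnorm_ge0 ?exprn_ge0 ?(ltW a0).
Unshelve. all: by end_near. Qed.
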